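(* Suppose $\mathbb{R}^n$ and $\mathbb{R}^m$ are endowed with (arbitrary) norms, both denoted $\|\cdot\|$. Let $A\in\mathbb{R}^{m\times n}$, let $g:\mathbb{R}^m\to\mathbb{R}\cup\{\infty\}$ be a convex differentiable function, and let $f=g\circ A$. Let $X\subseteq\mathbb{R}^n$ be a convex cone with $X\subseteq\mathrm{dom}(f)$ such that $A(X)$ is a linear subspace that contains more than one point. Let $D:X\times X\to\mathbb{R}_+$ be a distance-like function with $D(x,y)\le\frac12\|x-y\|^2$ for all $x,y\in X$. If $g$ is $\mu_g$-strongly convex for the norm $\|\cdot\|$ in $\mathbb{R}^m$ then \[ \mu_{f,X,D}\ \ge\ \frac{\mu_g}{\|(A|X)^{-1}\|^2}. \]
   Context: Distance-like: $D(y,x)\ge 0$ and $D(x,x)=0$ for all $x,y\in X$. Bregman distance: $D_f(y,x)=f(y)-f(x)-\langle\nabla f(x),y-x\rangle$. For nonempty $S\subseteq X$, $D_f(S,x):=\inf_{y\in S}D_f(y,x)$ and $D(S,x):=\inf_{y\in S}D(y,x)$. For $y\in X$, $Z_{f,X}(y):=\{x\in X: f(x)=f(y)\text{ and }\langle\nabla f(x)-\nabla f(y),x-y\rangle=0\}$. The relative strong convexity constant is \[ \mu_{f,X,D}:=\sup\{\mu\ge0:\ D_f(Z_{f,X}(y),x)\ge\mu\,D(Z_{f,X}(y),x)\text{ for all }x,y\in X\}. \] $g$ is $\mu_g$-strongly convex for $\|\cdot\|$ (with $\mu_g>0$) if $D_g(v,u)\ge\frac{\mu_g}{2}\|v-u\|^2$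 for all $u,v\in\mathrm{dom}(g)$. For a convex cone $C\subseteq\mathbb{R}^n$, \[ \|(A|C)^{-1}\|:=\sup_{v\in A(C),\,\|v\|\le1}\ \inf_{x\in C,\,Ax=v}\|x\|. \] *)

(* Defs.v *)
From HB Require Import structures.
From mathcomp Require Import all_boot all_order all_algebra.
From mathcomp Require Import all_classical all_reals all_analysis.

Set Implicit Arguments.
Unset Strict Implicit.
Unset Printing Implicit Defensive.

Import Order.TTheory GRing.Theory Num.Theory.
Import numFieldNormedType.Exports.

Local Open Scope classical_set_scope.
Local Open Scope ring_scope.

(* R^n is 'cV[R]_n. Its canonical normed-module structure (max norm) is used
   only for the topology, i.e. for neighborhoods and differentiability, which
   do not depend on the norm; the arbitrary norms of the theory are functions
   satisfying [is_norm]. *)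

Record is_norm (R : realType) (V : lmodType R) (N : V -> R) : Prop := IsNorm {
  norm_ge0 : forall x, 0 <= N x ;
  norm_eq0 : forall x, N x = 0 -> x = 0 ;
  norm_homog : forall (a : R) x, N (a *: x) = `|a| * N x ;
  norm_triangle : forall x y, N (x + y) <= N x + N y }.

Definition innerp (R : realType) (n : nat) (u v : 'cV[R]_n) : R :=
  (u^T *m v) 0 0.

(* The effective domain is only meaningful for functions that avoid -oo. *)
Definition dom (R : realType) (T : Type) (h : T -> \bar R) : set T :=
  [set x | (h x < +oo)%E].

Definition ereal_convex (R : realType) (V : lmodType R) (h : V -> \bar R) :
    Prop :=
  (forall x, h x != -oo%E) /\
  (forall (x y : V) (t : R), 0 <= t -> t <= 1 ->
    (h (t *: x + (1 - t) *: y)%R <= t%:E * h x + (1 - t)%:E * h y)%E).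

(* Differentiability of an extended-real-valued function at a point requires
   finiteness in a neighborhood, hence [dom h] is open below. *)
Definition ereal_differentiable (R : realType) (n : nat)
    (h : 'cV[R]_n -> \bar R) : Prop :=
  forall x, dom h x ->
    (\forall z \near x, h z \is a fin_num) /\ differentiable (fine \o h) x.

Definition gradient (R : realType) (n : nat) (h : 'cV[R]_n -> \bar R)
    (x : 'cV[R]_n) : 'cV[R]_n :=
  \col_i ('d (fine \o h) x (delta_mx i 0 : 'cV[R]_n)).

Definition bregman (R : realType) (n : nat) (h : 'cV[R]_n -> \bar R)
    (y x : 'cV[R]_n) : R :=
  fine (h y) - fine (h x) - innerp (gradient h x) (y - x).

Definition strongly_convex (R : realType) (n : nat) (N : 'cV[R]_n -> R)
    (mu : R) (h : 'cV[R]_n -> \bar R) : Prop :=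
  forall u v, dom h u -> dom h v -> mu / 2 * N (v - u) ^+ 2 <= bregman h v u.

Definition convex_cone (R : realType) (V : lmodType R) (C : set V) : Prop :=
  convex_set C /\ (forall (a : R) x, 0 < a -> C x -> C (a *: x)).

Definition linear_subspace (R : realType) (V : lmodType R) (S : set V) : Prop :=
  GRing.submod_closed [pred v | v \in S].

Definition distance_like (R : realType) (V : Type) (X : set V)
    (D : V -> V -> R) : Prop :=
  (forall x y, X x -> X y -> 0 <= D y x) /\ (forall x, X x -> D x x = 0).

Definition dist_set (R : realType) (V : Type) (D : V -> V -> R) (S : set V)
    (x : V) : \bar R :=
  ereal_inf [set (D y x)%:E | y in S].

Definition Zset (R : realType) (n : nat) (f : 'cV[R]_n -> \bar R)
    (X : set 'cV[R]_n) (y : 'cV[R]_n) : set 'cV[R]_n :=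
  [set x | [/\ X x, f x = f y &
               innerp (gradient f x - gradient f y) (x - y) = 0]].

(* Extended-real-valued: the supremum is +oo, e.g., when D vanishes on X. *)
Definition rel_strong_convexity (R : realType) (n : nat)
    (f : 'cV[R]_n -> \bar R) (X : set 'cV[R]_n)
    (D : 'cV[R]_n -> 'cV[R]_n -> R) : \bar R :=
  ereal_sup [set mu%:E | mu in [set mu : R | 0 <= mu /\
    forall x y, X x -> X y ->
      (mu%:E * dist_set D (Zset f X y) x
         <= dist_set (bregman f) (Zset f X y) x)%E]].

(* The norm of the set-valued inverse of the restriction of A to C. *)
Definition inv_norm (R : realType) (m n : nat) (Nm : 'cV[R]_m -> R)
    (Nn : 'cV[R]_n -> R) (A : 'M[R]_(m, n)) (C : set 'cV[R]_n) : \bar R :=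
  ereal_sup [set ereal_inf [set (Nn x)%:E | x in C `&` [set x | A *m x = v]] |
    v in (mulmx A @` C) `&` [set v | Nm v <= 1]].

(* Main.v *)
(* Adding the two strong convexity inequalities for z and y shows that
   <grad f(z) - grad f(y), z - y> = 0 forces A z = A y, so that
   Z(y) = {z in X | A z = A y} and D_f(z, x) = D_g(A y, A x) for z in Z(y), which
   is at least (mu_g / 2) |v|^2 with v = A y - A x. As A(X) is a subspace, v is in
   A(X), hence v = A w for some w in X with |w| arbitrarily close to
   |(A|X)^-1| |v|; then x + w is in Z(y) and D(x + w, x) <= |w|^2 / 2. *)

Require Import Defs.
From HB Require Import structures.
From mathcomp Require Import all_boot all_order all_algebra.
From mathcomp Require Import all_classical all_reals all_analysis.
From mathcomp Require Import ring.

Import Order.TTheory GRing.Theory Num.Theory.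
Import numFieldNormedType.Exports.

Local Open Scope classical_set_scope.
Local Open Scope ring_scope.

(** * Gradients and Bregman distances under composition with a matrix *)

Lemma mulmx_continuous (R : realType) (m n p : nat) (A : 'M[R]_(m, n)) :
  continuous (mulmx A : 'M[R]_(n, p) -> 'M[R]_(m, p)).
Proof.
move=> x; have Fx : Filter (nbhs x) by exact: nbhs_filter.
apply/(@cvg_ballP _ _ _ (nbhs x) Fx) => e e0.
(* Each entry of [A *m z] is a finite sum of constants times entries of [z]; the finitely many
   neighborhoods obtained are then intersected. *)
have coord i j : \forall z \near x, ball ((A *m x) i j) e ((A *m z) i j).
  apply: (@cvg_ball _ _ _ (nbhs x) Fx (fun z => (A *m z) i j)) => //.
  under eq_fun do rewrite mxE.
  rewrite mxE; apply: cvg_big => [|k _]; first exact: add_continuous.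
  by apply: cvgM; [exact: cvg_cst|exact: coord_continuous].
suff : \forall z \near x, forall i j, ball ((A *m x) i j) e ((A *m z) i j).
  by apply: filterS => z cz; split.
by apply: (filter_forall Fx) => i; apply: (filter_forall Fx) => j; exact: coord.
Qed.

(** The differential is a linear map by construction, so it is determined by its values on the basis
    vectors [delta_mx i 0], which are the entries of the gradient. *)
Lemma innerp_gradient (R : realType) (n : nat) (h : 'cV[R]_n -> \bar R)
    (x v : 'cV[R]_n) :
  innerp (gradient h x) v = 'd (fine \o h) x v.
Proof.
have -> : 'd (fine \o h) x v =
    'd (fine \o h) x (\sum_i v i 0 *: (delta_mx i 0 : 'cV[R]_n)).
  congr ('d _ _ _); rewrite {1}(matrix_sum_delta v).
  by apply: eq_bigr => i _; rewrite big_ord1.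
rewrite linear_sum /innerp mxE; apply: eq_bigr => i _.
by rewrite linearZ /= mxE mxE mulrC.
Qed.

(** Chain rule: the gradient of [h \o mulmx A] at [x] is [A^T] times that of [h] at [A *m x],
    written here in adjoint form. *)
Lemma innerp_gradient_comp (R : realType) (m n : nat) (A : 'M[R]_(m, n))
    (h : 'cV[R]_m -> \bar R) (x v : 'cV[R]_n) :
  differentiable (fine \o h) (A *m x) ->
  innerp (gradient (h \o mulmx A) x) v = innerp (gradient h (A *m x)) (A *m v).
Proof.
move=> dh; have cA := @mulmx_continuous R m n 1 A.
have dA : differentiable (mulmx A : 'cV[R]_n -> 'cV[R]_m) x.
  exact: (@linear_differentiable _ _ _ (mulmx A)).
have := diff_comp dA dh.
rewrite (@diff_lin _ _ _ (mulmx A : {linear _ -> _}) x cA) => e.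
rewrite innerp_gradient.
rewrite -[LHS]/(('d (fine \o h \o mulmx A) x : _ -> _) v).
rewrite e.
by rewrite /= -innerp_gradient.
Qed.

Lemma bregman_comp (R : realType) (m n : nat) (A : 'M[R]_(m, n))
    (h : 'cV[R]_m -> \bar R) (x y : 'cV[R]_n) :
  differentiable (fine \o h) (A *m x) ->
  bregman (h \o mulmx A) y x = bregman h (A *m y) (A *m x).
Proof. by move=> dh; rewrite /bregman innerp_gradient_comp //= mulmxBr. Qed.

Lemma innerpBl (R : realType) (n : nat) (u v w : 'cV[R]_n) :
  innerp (u - v) w = innerp u w - innerp v w.
Proof. by rewrite /innerp linearB /= mulmxBl !mxE. Qed.

Lemma innerpNr (R : realType) (n : nat) (u v : 'cV[R]_n) :
  innerp u (- v) = - innerp u v.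
Proof. by rewrite /innerp mulmxN mxE. Qed.

Lemma innerp_gradientB_comp (R : realType) (m n : nat) (A : 'M[R]_(m, n))
    (h : 'cV[R]_m -> \bar R) (x y : 'cV[R]_n) :
  differentiable (fine \o h) (A *m x) -> differentiable (fine \o h) (A *m y) ->
  innerp (gradient (h \o mulmx A) x - gradient (h \o mulmx A) y) (x - y) =
  innerp (gradient h (A *m x) - gradient h (A *m y)) (A *m x - A *m y).
Proof.
move=> dx dy; rewrite innerpBl.
transitivity (innerp (gradient h (A *m x)) (A *m (x - y)) -
    innerp (gradient h (A *m y)) (A *m (x - y))).
  by congr (_ - _); exact: innerp_gradient_comp.
by rewrite -innerpBl mulmxBr.
Qed.

(** The function values cancel in the sum. This links the second condition in [Zset] to Bregman
    distances. *)
Lemma bregman_symm_sum (R : realType) (n : nat) (h : 'cV[R]_n -> \bar R)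
    (u v : 'cV[R]_n) :
  bregman h u v + bregman h v u =
  innerp (gradient h u - gradient h v) (u - v).
Proof.
have key (a b : R) (p q : 'cV[R]_n) :
    a - b - innerp q (u - v) + (b - a - innerp p (v - u)) =
    innerp (p - q) (u - v).
  have -> : innerp p (v - u) = - innerp p (u - v) by rewrite -innerpNr opprB.
  by rewrite innerpBl; ring.
exact: key.
Qed.

(** * Norms, convex cones and the norm of the set-valued inverse *)

Lemma is_norm0 (R : realType) (V : lmodType R) (N : V -> R) :
  is_norm N -> N 0 = 0.
Proof. by move=> nN; rewrite -(scale0r 0) norm_homog // normr0 mul0r. Qed.

(** The sum is twice the midpoint of [x] and [y]. *)
Lemma convex_coneD (R : realType) (V : lmodType R) (C : set V) (x y : V) :
  convex_cone C -> C x -> C y -> C (x + y).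
Proof.
move=> [convC scaleC] Cx Cy.
have h01 : 0 <= 2^-1 :> R by rewrite invr_ge0.
have h1 : 2^-1 <= 1 :> R by rewrite invf_le1 // ler1n.
have := convC x y (Itv01 h01 h1) (mem_set Cx) (mem_set Cy).
rewrite inE => /(scaleC 2 _ (ltr0Sn _ 1)).
congr C; rewrite [conv _ _ _]/(2^-1 *: x + (1 - 2^-1) *: y).
rewrite scalerDr !scalerA; congr (_ + _); rewrite -[RHS]scale1r; congr (_ *: _).
  by rewrite divff.
by rewrite mulrDr mulr1 mulrN divff // addrK.
Qed.

(** The vector [0] competes in the supremum, and its inner infimum runs over norms. *)
Lemma inv_norm_ge0 (R : realType) (m n : nat) (Nm : 'cV[R]_m -> R)
    (Nn : 'cV[R]_n -> R) (A : 'M[R]_(m, n)) (X : set 'cV[R]_n) :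
  is_norm Nm -> is_norm Nn -> (mulmx A @` X) 0 ->
  (0 <= inv_norm Nm Nn A X)%E.
Proof.
move=> Nm_norm Nn_norm AX0; apply: (@le_trans _ _
    (ereal_inf [set (Nn x)%:E | x in X `&` [set x | A *m x = 0]])).
  by apply/ereal_infP => _ [x _ <-]; rewrite lee_fin norm_ge0.
apply: ereal_sup_ubound; exists 0 => //; split=> //.
by rewrite /= is_norm0 // ler01.
Qed.

(** Apply the definition to [v] scaled to norm 1, then scale the preimage back. The inequality on
    [K] is strict because the infimum need not be attained. *)
Lemma inv_norm_preimage (R : realType) (m n : nat) (Nm : 'cV[R]_m -> R)
    (Nn : 'cV[R]_n -> R) (A : 'M[R]_(m, n)) (X : set 'cV[R]_n) (K : R)
    (v : 'cV[R]_m) :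
  is_norm Nm -> is_norm Nn ->
  convex_cone X -> (mulmx A @` X) v -> v <> 0 ->
  (inv_norm Nm Nn A X < K%:E)%E ->
  exists2 w, X w & A *m w = v /\ Nn w <= K * Nm v.
Proof.
move=> Nm_norm Nn_norm [_ scaleX] [x Xx Axv] v0 ltK.
have N0 : 0 < Nm v.
  by rewrite lt_neqAle norm_ge0 // andbT eq_sym; apply/eqP => /(norm_eq0 Nm_norm).
pose u := (Nm v)^-1 *: v.
have : (ereal_inf [set (Nn x)%:E | x in X `&` [set x | (A *m x = u)%R]] < K%:E)%E.
  apply: le_lt_trans ltK; apply: ereal_sup_ubound; exists u => //; split.
    exists ((Nm v)^-1 *: x); first by apply: scaleX; rewrite ?invr_gt0.
    by rewrite -scalemxAr Axv.
  by rewrite /u /= norm_homog // gtr0_norm ?invr_gt0 // mulVf // gt_eqF.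
move=> /ereal_inf_ltP [_ [w [Xw Awu] <-]]; rewrite lte_fin => wK.
exists (Nm v *: w); first exact: scaleX.
split; first by rewrite -scalemxAr Awu /u scalerA divff ?scale1r // gt_eqF.
by rewrite norm_homog // gtr0_norm // mulrC ler_wpM2r // ltW.
Qed.

(** * The sets [Zset] as fibres of [A] in [X], and the distance to them *)

Lemma Zset_comp (R : realType) (m n : nat) (Nm : 'cV[R]_m -> R)
    (A : 'M[R]_(m, n)) (g : 'cV[R]_m -> \bar R) (X : set 'cV[R]_n) (mu : R)
    (y : 'cV[R]_n) :
  is_norm Nm -> ereal_differentiable g -> X `<=` dom (g \o mulmx A) ->
  0 < mu -> strongly_convex Nm mu g -> X y ->
  Zset (g \o mulmx A) X y = [set z | X z /\ A *m z = A *m y].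
Proof.
move=> Nm_norm dg Xdom mu0 sg Xy; apply/seteqP; split=> z /=; last first.
  move=> [Xz Azy]; split=> //=; first by rewrite Azy.
  rewrite innerp_gradientB_comp; last exact: (dg _ (Xdom _ Xy)).2.
    have -> : A *m z - A *m y = 0 by rewrite Azy subrr.
    by rewrite /innerp mulmx0 mxE.
  exact: (dg _ (Xdom _ Xz)).2.
move=> [Xz _]; have dz := (dg _ (Xdom _ Xz)).2; have dy := (dg _ (Xdom _ Xy)).2.
rewrite innerp_gradientB_comp // -bregman_symm_sum.
move=> e; split=> //; apply/eqP; rewrite -subr_eq0; apply/eqP.
apply: (norm_eq0 Nm_norm).
have b1 := sg _ _ (Xdom _ Xy) (Xdom _ Xz).
have b2 : 0 <= bregman g (A *m y) (A *m z).
  apply: le_trans (sg _ _ (Xdom _ Xz) (Xdom _ Xy)).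
  by rewrite mulr_ge0 ?sqr_ge0 // divr_ge0 // ltW.
(* The two Bregman distances sum to 0 by [e]; dropping the nonnegative one in [b2] leaves the one
   bounded below in [b1]. *)
have : mu / 2 * Nm (A *m z - A *m y) ^+ 2 <= 0.
  by apply: (le_trans b1); rewrite -e lerDl.
rewrite pmulr_rle0 ?divr_gt0 // => le0; apply/eqP.
by rewrite -sqrf_eq0 eq_le le0 sqr_ge0.
Qed.

Lemma dist_set_preimage_le (R : realType) (m n : nat) (Nm : 'cV[R]_m -> R)
    (Nn : 'cV[R]_n -> R) (A : 'M[R]_(m, n)) (X : set 'cV[R]_n)
    (D : 'cV[R]_n -> 'cV[R]_n -> R) (H : R) (x y : 'cV[R]_n) :
  is_norm Nm -> is_norm Nn -> convex_cone X ->
  linear_subspace (mulmx A @` X) -> distance_like X D ->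
  (forall x y, X x -> X y -> D x y <= 2^-1 * Nn (x - y) ^+ 2) ->
  inv_norm Nm Nn A X = H%:E -> X x -> X y ->
  (dist_set D [set z | X z /\ A *m z = A *m y] x <=
     (2^-1 * (H ^+ 2 * Nm (A *m y - A *m x) ^+ 2))%:E)%E.
Proof.
move=> Nm_norm Nn_norm Xcone AXsub [_ Dxx] D_le invH Xx Xy.
have [AX0 AXlin] := AXsub.
have H0 : 0 <= H.
  rewrite -lee_fin -invH; apply: inv_norm_ge0 => //.
  by move: AX0; rewrite inE.
set v := A *m y - A *m x.
(* If [v] is 0, there is nothing to normalize, but [x] itself lies in the fibre and [D x x] is 0. *)
have [v0|v0] := eqVneq v 0.
  rewrite v0 is_norm0 // expr0n /= !mulr0.
  apply: ereal_inf_lbound; exists x; last by rewrite Dxx.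
  by split=> //; apply/eqP; rewrite eq_sym -subr_eq0 -/v v0.
(* A cone alone need not contain differences; here [A(X)] is a linear subspace. *)
have AXv : (mulmx A @` X) v.
  have := AXlin (-1) (A *m x) (A *m y); rewrite !inE scaleN1r addrC => AXl.
  by apply: AXl; [exists x|exists y].
have N0 : 0 < Nm v.
  by rewrite lt_neqAle norm_ge0 // andbT eq_sym; apply: contra v0 => /eqP
    /(norm_eq0 Nm_norm) ->.
(* A preimage of norm at most [H * Nm v] may not exist, so the bound is proved up to an arbitrary
   [e]. *)
apply/lee_addgt0Pr => e e0.
(* K > H is chosen so that (K |v|)^2 / 2 exceeds (H |v|)^2 / 2 by exactly e. *)
pose K := Num.sqrt (H ^+ 2 + 2 * e / Nm v ^+ 2).
have d0 : 0 < 2 * e / Nm v ^+ 2 by rewrite divr_gt0 ?exprn_gt0 ?mulr_gt0.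
have HK : H < K.
  rewrite -(ger0_norm H0) -sqrtr_sqr ltr_sqrt ?ltrDl //.
  by rewrite ltr_wpDl ?sqr_ge0.
have K2 : K ^+ 2 * Nm v ^+ 2 = H ^+ 2 * Nm v ^+ 2 + 2 * e.
  rewrite sqr_sqrtr ?addr_ge0 ?sqr_ge0 ?(ltW d0) // mulrDl divfK //.
  by rewrite sqrf_eq0 gt_eqF.
have [|w Xw [Awv wK]] := inv_norm_preimage R m n Nm Nn A X K v Nm_norm Nn_norm
  Xcone AXv (elimN eqP v0).
  by rewrite invH lte_fin.
have Xxw : X (x + w) by exact: convex_coneD.
apply: (@le_trans _ _ (D (x + w) x)%:E).
  apply: ereal_inf_lbound; exists (x + w) => //; split=> //.
  by rewrite mulmxDr Awv /v addrC subrK.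
rewrite -EFinD lee_fin; apply: (le_trans (D_le _ _ Xxw Xx)).
rewrite addrC addKr.
have -> : 2^-1 * (H ^+ 2 * Nm v ^+ 2) + e = 2^-1 * (K * Nm v) ^+ 2.
  by rewrite exprMn K2 mulrDr mulKf.
have KN0 : 0 <= K * Nm v by rewrite mulr_ge0 ?sqrtr_ge0 // ltW.
by rewrite ler_pM2l ?invr_gt0 // lerXn2r // nnegrE (norm_ge0 Nn_norm).
Qed.

Theorem theorem1 (R : realType) (m n : nat)
    (Nm : 'cV[R]_m -> R) (Nn : 'cV[R]_n -> R)
    (Nm_norm : is_norm Nm) (Nn_norm : is_norm Nn)
    (A : 'M[R]_(m, n)) (g : 'cV[R]_m -> \bar R)
    (g_convex : ereal_convex g) (g_diff : ereal_differentiable g)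
    (X : set 'cV[R]_n)
    (X_cone : convex_cone X)
    (X_dom : X `<=` dom (g \o mulmx A))
    (AX_subspace : linear_subspace (mulmx A @` X))
    (AX_nontrivial : exists u v : 'cV[R]_m,
       [/\ (mulmx A @` X) u, (mulmx A @` X) v & u <> v])
    (D : 'cV[R]_n -> 'cV[R]_n -> R)
    (D_dist : distance_like X D)
    (D_le : forall x y, X x -> X y -> D x y <= 2^-1 * Nn (x - y) ^+ 2)
    (mu_g : R) (mu_g_gt0 : 0 < mu_g)
    (g_strong : strongly_convex Nm mu_g g) :
  (mu_g%:E / inv_norm Nm Nn A X ^+ 2
     <= rel_strong_convexity (g \o mulmx A) X D)%E.
Proof.
have [AX0 _] := AX_subspace; rewrite inE in AX0.
have H0 := inv_norm_ge0 R m n Nm Nn A X Nm_norm Nn_norm AX0.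
have breg x y : X x -> X y ->
    mu_g / 2 * Nm (A *m y - A *m x) ^+ 2 <= bregman (g \o mulmx A) y x.
  move=> Xx Xy; rewrite bregman_comp; last exact: (g_diff _ (X_dom _ Xx)).2.
  exact: (g_strong _ _ (X_dom _ Xx) (X_dom _ Xy)).
have breg0 x y : X x -> X y -> 0 <= bregman (g \o mulmx A) y x.
  move=> Xx Xy; apply: le_trans (breg _ _ Xx Xy).
  by rewrite mulr_ge0 ?sqr_ge0 // divr_ge0 // ltW.
(* With the conventions +oo^-1 = 0 and 0^-1 = +oo, an infinite inverse norm makes
   the bound 0, and a vanishing one makes it +oo. *)
have [H|] := eqVneq (inv_norm Nm Nn A X) +oo%E.
  rewrite H expe2 mulyy invey mule0; apply: ereal_sup_ubound.
  (* The constant 0 is admissible because Bregman distances are nonnegative on [X]. *)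
  exists 0 => //; split=> // x y Xx Xy; rewrite mul0e.
  by apply/ereal_infP => _ [z [Xz _ _] <-]; rewrite lee_fin breg0.
case E : (inv_norm Nm Nn A X) H0 => [H| |] // H0 _; rewrite lee_fin in H0.
(* The condition on [mu] is a product rather than a quotient, so that it also covers [H = 0]. *)
have key mu : 0 <= mu -> mu * H ^+ 2 <= mu_g ->
    (mu%:E <= rel_strong_convexity (g \o mulmx A) X D)%E.
  move=> mu0 muH; apply: ereal_sup_ubound; exists mu => //; split=> // x y Xx Xy.
  rewrite (Zset_comp R m n Nm A g X mu_g y Nm_norm g_diff X_dom mu_g_gt0) //.
  (* Each [z] in the fibre can be treated separately: the lower bound on its Bregman distance
     depends only on [A *m y - A *m x]. *)
  apply/ereal_infP => _ [z [Xz Azy] <-].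
  have := dist_set_preimage_le R m n Nm Nn A X D H x y Nm_norm Nn_norm
    X_cone AX_subspace D_dist D_le E Xx Xy.
  have mu0E : (0%:E <= mu%:E)%E by rewrite lee_fin.
  move=> /(lee_wpmul2l mu0E) /le_trans; apply.
  rewrite -EFinM lee_fin; apply: le_trans (breg _ _ Xx Xz); rewrite Azy.
  move: (Nm _) => N.
  have -> : mu * (2^-1 * (H ^+ 2 * N ^+ 2)) = mu * H ^+ 2 / 2 * N ^+ 2 by field.
  by rewrite !ler_wpM2r ?sqr_ge0 ?invr_ge0.
have [H00|Hn0] := eqVneq H 0.
  (* For [H = 0] every positive real is admissible, so the supremum is infinite. *)
  rewrite (_ : rel_strong_convexity _ _ _ = +oo%E) ?leey //.
  apply/eqyP => r r0; apply: key; first exact: ltW.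
  by rewrite H00 expr0n mulr0 ltW.
rewrite -EFin_expe inver sqrf_eq0 (negPf Hn0) -EFinM; apply: key.
  by rewrite divr_ge0 ?sqr_ge0 // ltW.
by rewrite divfK // sqrf_eq0.
Qed.
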